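(* For each positive integer $n$ let $N_5=5(n+1)$ and $b\in\mathbb{Z}_{N_5}$. Then, as $n\to\infty$, $$M_{5,1,n}(b)=\begin{cases}\dfrac{4\cdot 5^{n}}{n+1}(1+o(1)),& 5\mid b,\\[2mm] -\dfrac{5^{n}}{n+1}(1+o(1)),&\text{otherwise.}\end{cases}$$ In particular, $M_{5,1,n}(b)>0$ when $b\equiv 0\pmod 5$ and $M_{5,1,n}(b)<0$ when $b\not\equiv 0\pmod 5$, for all $n>0$.
   Context: For a prime $p$ and positive integers $s,n$, put $N_p=(n+1)p$, $D_p=\{x\in\mathbb{Z}:1\leq x\leq pn+p-1,\ p\nmid x\}$, and for $b\in\mathbb{Z}_{N_p}$ let $M_{p,s,n}(b)=\sum (-1)^{|V_1|+\cdots+|V_s|}$, the sum over all $s$-tuples $(V_1,\ldots,V_s)$ of subsets of $D_p$ with $\sum_{i=1}^s\sum_{x\in V_i}x\equiv b\pmod{N_p}$. Equivalently, $M_{p,s,n}(b)$ is the sum of the coefficients of $q^i$, $i\equiv b\pmod{N_p}$, in $\prod_{j=0}^n\prod_{k=1}^{p-1}(1-q^{pj+k})^s$. *)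

(* Defs.v *)
From HB Require Import structures.
From mathcomp Require Import all_boot all_order all_algebra.

Set Implicit Arguments.
Unset Strict Implicit.
Unset Printing Implicit Defensive.

Import Order.TTheory GRing.Theory Num.Theory.
Local Open Scope ring_scope.

Definition N (p n : nat) : nat := (n.+1 * p)%N.

(* D_p lies in {0, ..., pn + p - 1}, the values of 'I_(p * n + p). *)
Definition D (p n : nat) : {set 'I_(p * n + p)} :=
  [set x : 'I_(p * n + p) | (1 <= x <= p * n + p - 1)%N && ~~ (p %| x)%N].

(* 'Z_(N p n) is the ring of integers modulo N p n only when N p n > 1, which
   holds for p prime and n > 0. *)
Definition M (p s n : nat) (b : 'Z_(N p n)) : int :=
  \sum_(V : {ffun 'I_s -> {set 'I_(p * n + p)}}
         | [forall i, V i \subset D p n]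
           && (\sum_(i < s) \sum_(x in V i) (nat_of_ord x)%:R == b))
     (-1) ^+ (\sum_(i < s) #|V i|)%N.

(* Main.v *)
(* Let P(w) be the product of 1 - w^x over x in D_p. Fourier inversion on Z_N
   gives N * M(b) as the sum of w^(-b) P(w) over the N-th roots of unity w. If w
   has order d, then P(w) = p^(N/d) when p divides d: writing x = y p + k, the
   product over y runs N/d times over the d/p-th roots of unity, which leaves the
   (N/d)-th power of the product of 1 - h^k, 0 < k < p, for a primitive p-th root
   of unity h. Otherwise d itself lies in D_p and P(w) = 0. The roots of order
   d = p contribute p^(n+1) times a Ramanujan sum, equal to p - 1 or -1; every
   other one contributes at most p^((n+1)/2) in absolute value. *)
Require Import Defs.
From HB Require Import structures.
From mathcomp Require Import all_boot all_order all_algebra all_field.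
From mathcomp Require Import all_classical all_reals all_analysis.
From mathcomp Require Import zify ring.
Import Order.TTheory GRing.Theory Num.Theory.
Import numFieldNormedType.Exports.
Local Open Scope classical_set_scope.
Local Open Scope ring_scope.


(** * Fourier inversion over the N-th roots of unity *)

Lemma prod_subX_subset (R : comNzRingType) (w : R) (m : nat) (A : {set 'I_m}) :
  \prod_(x in A) (1 - w ^+ x) =
  \sum_(V : {set 'I_m} | V \subset A)
     (-1) ^+ #|V| * w ^+ (\sum_(x in V) (x : nat))%N.
Proof.
rewrite big_mkcond /=.
(* Factors outside [A] become 0 + 1, so in the expansion over all subsets only those contained in
   [A] survive. *)
under eq_bigr => x _.
  have -> : (if x \in A then 1 - w ^+ x else 1) =
            (if x \in A then - w ^+ x else 0) + 1.
    by case: ifP => _; rewrite addrC ?addr0.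
  over.
rewrite bigA_distr big_mkcond [RHS]big_mkcond /=; apply: eq_bigr => V _.
rewrite -big_mkcond /=; case: ifPn => [sVA|/subsetPn[x xV xA]]; last first.
  by rewrite (bigD1 x) //= (negPf xA) mul0r.
rewrite -prodr_const -prodrXr -big_split /=; apply: eq_bigr => x xV.
by rewrite (fintype.subsetP sVA) // mulN1r.
Qed.

Lemma M1_sum_set (p n : nat) (b : 'Z_(N p n)) :
  M 1 b = \sum_(V : {set 'I_(p * n + p)} | (V \subset D p n)
             && ((\sum_(x in V) (x : nat))%N%:R == b)) (-1) ^+ #|V|.
Proof.
rewrite /M (reindex (fun V : {set 'I_(p * n + p)} => [ffun _ : 'I_1 => V])) /=.
  apply: eq_big => [V|V _]; last by rewrite big_ord1 ffunE.
  rewrite big_ord1 ffunE natr_sum; congr (_ && _).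
  by apply/forallP/idP => [/(_ ord0)|sVD i]; rewrite ffunE.
exists (fun f : {ffun 'I_1 -> {set 'I_(p * n + p)}} => f ord0) => [V _|f _].
  by rewrite ffunE.
by apply/ffunP => i; rewrite ffunE [i]ord1.
Qed.

Lemma sum_prim_root (F : fieldType) (m k : nat) (z : F) :
  m.-primitive_root z ->
  \sum_(j < m) z ^+ (j * k) = if (m %| k)%N then m%:R else 0.
Proof.
move=> zP; under eq_bigr do rewrite mulnC exprM.
case: ifPn => [|mk].
  rewrite (prim_order_dvd zP) => /eqP->; under eq_bigr do rewrite expr1n.
  by rewrite sumr_const card_ord.
have zk1 : z ^+ k - 1 != 0 by rewrite subr_eq0 -(prim_order_dvd zP).
apply: (mulfI zk1); rewrite mulr0 -subrX1 -exprM mulnC exprM.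
by rewrite (prim_expr_order zP) expr1n subrr.
Qed.

(** The natural number [m - b] stands for -b, which turns the congruence into the divisibility
    tested by [sum_prim_root]. *)
Lemma Zp_natr_eq (m k : nat) (b : 'Z_m) : (1 < m)%N ->
  (k%:R == b) = (m %| k + (m - b))%N.
Proof.
move=> m1; have bm : (b < m)%N by rewrite -[X in (_ < X)%N](Zp_cast m1).
rewrite -val_eqE /= val_Zp_nat // -[X in _ == X](modn_small bm).
by rewrite -(eqn_modDr (m - b)) subnKC ?modnn // ltnW.
Qed.

Lemma M1_fourier (p n : nat) (b : 'Z_(N p n)) (F : fieldType) (z : F) :
  (1 < N p n)%N -> (N p n).-primitive_root z ->
  (N p n)%:R * (M 1 b)%:~R =
  \sum_(j < N p n) z ^+ (j * (N p n - b)) *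
                   \prod_(x in D p n) (1 - (z ^+ j) ^+ x).
Proof.
move=> N1 zP.
under eq_bigr do rewrite prod_subX_subset mulr_sumr.
rewrite exchange_big /= M1_sum_set rmorph_sum mulr_sumr big_mkcondr /=.
apply: eq_bigr => V _.
under [RHS]eq_bigr do
  rewrite mulrCA -exprM -exprD -mulnDr [(N p n - b + _)%N]addnC.
rewrite -mulr_sumr (sum_prim_root _ _ _ _ zP) (Zp_natr_eq _ _ _ N1).
by case: ifP => _; rewrite ?mulr0 // mulrC rmorphXn rmorphN1.
Qed.

(** * Products over roots of unity *)

Lemma prod_sub_prim_root (F : fieldType) (e : nat) (u c : F) :
  e.-primitive_root u -> \prod_(0 <= i < e) (1 - c * u ^+ i) = 1 - c ^+ e.
Proof.
move=> uP; have e0 := prim_order_gt0 uP.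
have [->|c0] := eqVneq c 0.
  by rewrite expr0n eqn0Ngt e0 subr0 big1 // => i _; rewrite mul0r subr0.
(* Evaluate the factorization of X^e - 1 at 1/c and scale by c^e; hence the separate case c = 0. *)
have := congr1 (fun q => q.[c^-1]) (factor_Xn_sub_1 uP).
rewrite horner_prod !hornerE => H.
have -> : 1 - c ^+ e = c ^+ e * (c^-1 ^+ e - 1).
  by rewrite mulrBr mulr1 exprVn divff // expf_neq0.
rewrite -H -[in c ^+ e](subn0 e) -prodr_const_nat -big_split /=.
by apply: eq_bigr => i _; rewrite !hornerE mulrBr divff.
Qed.

Lemma prod_sub_prim_root_ne1 (F : fieldType) (e : nat) (u : F) :
  e.-primitive_root u -> \prod_(1 <= i < e) (1 - u ^+ i) = e%:R.
Proof.
move=> uP; have e0 := prim_order_gt0 uP.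
(* Cancel X - 1 from the two factorizations of X^e - 1, then evaluate at 1. *)
have H := factor_Xn_sub_1 uP; rewrite big_ltn // expr0 subrX1 in H.
have X1 : 'X - (1 : F)%:P != 0 by rewrite polyXsubC_eq0.
move: H; rewrite -[X in 'X - X]polyC1 => /(mulfI X1).
move/(congr1 (fun q => q.[1])); rewrite horner_prod horner_sum.
under eq_bigr do rewrite !hornerE.
under [X in _ = X]eq_bigr do rewrite hornerXn expr1n.
by rewrite sumr_const card_ord.
Qed.

Lemma prod_D (R : comNzRingType) (p n : nat) (G : nat -> R) : (0 < p)%N ->
  \prod_(x in D p n) G x =
  \prod_(1 <= k < p) \prod_(0 <= y < n.+1) G (y * p + k)%N.
Proof.
move=> p0; rewrite exchange_big_nat /=.
have -> : \prod_(x in D p n) G x =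
          \prod_(0 <= x < n.+1 * p | ~~ (p %| x)%N) G x.
  rewrite mulSnr [(n * p)%N]mulnC big_mkord; apply: eq_bigl => x.
  rewrite inE; case: (boolP (p %| x)%N) => [|px]; first by rewrite andbF.
  rewrite andbT; apply/andP; split; last by have := ltn_ord x; lia.
  by rewrite lt0n; apply: contraNneq px => ->.
rewrite big_mkcond big_nat_mul; apply: eq_bigr => y _.
rewrite -{1}[(y * p)%N]add0n mulSn big_addn addnK.
rewrite big_ltn // add0n dvdn_mull //= mul1r; apply: eq_big_nat => k /andP[k0 kp].
by rewrite dvdn_addl ?dvdn_mull // gtnNdvd // addnC.
Qed.

Lemma prod_D_prim_root (F : fieldType) (p n d : nat) (w : F) :
  prime p -> (d %| N p n)%N -> d.-primitive_root w ->
  \prod_(x in D p n) (1 - w ^+ x) =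
  if (p %| d)%N then p%:R ^+ (N p n %/ d) else 0.
Proof.
move=> pP dN wP; have p0 := prime_gt0 pP; have d0 := prim_order_gt0 wP.
case: ifPn => [/dvdnP[e de]|pd]; last first.
  (* [d] divides N but differs from it, since p divides N and not [d]; so [d] is in the range of
     [D p n]. *)
  have dlt : (d < p * n + p)%N.
    have dle : (d <= n.+1 * p)%N by apply: dvdn_leq => //; rewrite muln_gt0.
    rewrite addnC -mulnS mulnC ltn_neqAle dle andbT.
    by apply: contraNneq pd => ->; rewrite dvdn_mull.
  have dD : Ordinal dlt \in D p n by rewrite inE /= pd; lia.
  by rewrite (bigD1 _ dD) /= (prim_expr_order wP) subrr mul0r.
have e0 : (0 < e)%N by move: d0; rewrite de muln_gt0 => /andP[].
have /dvdnP[q nq] : (e %| n.+1)%N by move: dN; rewrite de dvdn_pmul2r.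
have -> : (N p n %/ d = q)%N by rewrite /N nq de -mulnA mulnK // muln_gt0 e0.
have uP : e.-primitive_root (w ^+ p).
  by have := exp_prim_root wP p; rewrite de (gcdn_idPl _) ?dvdn_mull ?mulnK.
have vP : p.-primitive_root (w ^+ e).
  by have := exp_prim_root wP e; rewrite de (gcdn_idPl _) ?dvdn_mulr ?mulKn.
rewrite (prod_D _ p n (fun x => 1 - w ^+ x) p0).
rewrite -[in RHS](prod_sub_prim_root_ne1 _ _ _ vP) -prodrXl.
apply: eq_bigr => k _.
(* Each of the q blocks of e consecutive y runs once through the powers of w^p and yields 1 - w^(k
   e). *)
rewrite nq big_nat_mul -[in RHS](subn0 q) -prodr_const_nat.
apply: eq_bigr => i _.
have -> : w ^+ e ^+ k = w ^+ k ^+ e by rewrite -!exprM mulnC.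
rewrite -(prod_sub_prim_root _ _ _ _ uP).
rewrite -{1}[(i * e)%N]add0n mulSn big_addn addnK.
apply: eq_bigr => y _; congr (1 - _).
(* The offset i e of a block drops out because w^(p e) = 1. *)
rewrite exprD mulrC mulnC exprM exprD [(i * e)%N]mulnC [_ ^+ (e * i)]exprM.
by rewrite -[(w ^+ p) ^+ e]exprM mulnC -de (prim_expr_order wP) expr1n mulr1.
Qed.

(** * Size of the contributions from orders not dividing p *)

Lemma sum_nat_dvd (V : nmodType) (m q : nat) (T : nat -> V) : (0 < q)%N ->
  \sum_(0 <= j < m * q | (q %| j)%N) T j = \sum_(0 <= k < m) T (k * q)%N.
Proof.
move=> q0; rewrite big_mkcond big_nat_mul; apply: eq_bigr => k _.
rewrite big_ltn ?ltn_pmul2r // dvdn_mull // big_nat big1 => [|j].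
  exact: addr0.
case/andP=> kj jk; case: ifPn => // /dvdnP[i ji].
by move: kj jk; rewrite ji !ltn_pmul2r //; lia.
Qed.

Lemma sum_nat_ndvd_const (m q c : nat) : (0 < q)%N ->
  (\sum_(0 <= j < m * q | ~~ (q %| j)) c = m * q.-1 * c)%N.
Proof.
move=> q0; have := sum_nat_dvd nat m q (fun=> c) q0.
rewrite sum_nat_const_nat subn0 => Hq.
have := sum_nat_const_nat 0 (m * q) c; rewrite subn0.
rewrite (bigID (fun j => q %| j)%N) /= => H.
have {}Hq : (\sum_(0 <= j < m * q | q %| j) c = m * c)%N by exact: Hq.
by rewrite Hq in H; case: q q0 H {Hq} => // q _ H; nia.
Qed.

(* The absolute values of the Fourier terms of [M 1] at z ^ j, n + 1 not dividing
   j, where z is a primitive N-th root of unity: z ^ j has order N / gcd(j, N). *)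
Definition M1_error (p n : nat) : nat :=
  (\sum_(0 <= j < p * n.+1 | ~~ (n.+1 %| j))
    let g := gcdn j (p * n.+1) in if p %| (p * n.+1) %/ g then p ^ g else 0)%N.

(** There are p n indices j not divisible by n+1. For a nonzero term, n+1 = m g with g = gcd(j, N);
    m = 1 would force n+1 to divide j, so m >= 2 and g <= (n+1)/2. *)
Lemma M1_error_le (p n : nat) : (0 < p)%N ->
  (M1_error p n <= p * n * p ^ (n.+1)./2)%N.
Proof.
move=> p0; rewrite -[X in (p * X)%N]/(n.+1.-1) -sum_nat_ndvd_const //.
apply: leq_sum => j nj /=; case: ifPn => // /dvdnP[m Hm].
apply: leq_pexp2l => //; set g := gcdn _ _ in Hm *.
have gN : (g %| p * n.+1)%N by exact: dvdn_gcdr.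
have nE : n.+1 = (m * g)%N.
  by apply/eqP; rewrite -(eqn_pmul2l p0) -(divnK gN) Hm; apply/eqP; ring.
have m1 : m != 1%N.
  by apply: contraNneq nj => m1; rewrite nE m1 mul1n dvdn_gcdl.
have m0 : m != 0%N by apply: contra_eq_neq nE => ->.
have m2 : (2 <= m)%N by lia.
have : (2 * g <= n.+1)%N by rewrite nE leq_mul2r m2 orbT.
by rewrite uphalfE; lia.
Qed.

Lemma M1_5_error_lt (n : nat) : (0 < n)%N -> (M1_error 5 n < 5 ^ n.+1)%N.
Proof.
(* At n = 1 the bound [M1_error_le] is exactly 25 = 5^2, hence not strict, so the sum itself is
   computed. *)
case: n => // -[_|n _]; first by rewrite /M1_error unlock; vm_compute.
apply: (leq_ltn_trans (M1_error_le 5 n.+2 isT)).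
rewrite expnS -mulnA ltn_pmul2l //.
(* With m = [n./2] this dominates n + 2, the factor left once the powers of 5 cancel. *)
have H m : (m.*2.+3 < 5 ^ m.+1)%N.
  by elim: m => // m IH; rewrite expnS; move: IH; lia.
have -> : (5 ^ n.+2 = 5 ^ n./2.+1 * 5 ^ (n.+3)./2)%N.
  by rewrite -expnD; congr (5 ^ _)%N; lia.
rewrite ltn_pmul2r ?expn_gt0 //; apply: leq_ltn_trans (H n./2); lia.
Qed.

(** * Separating the main term from the error *)

Lemma prod_D_expr (F : fieldType) (p n j : nat) (z : F) :
  prime p -> (N p n).-primitive_root z ->
  \prod_(x in D p n) (1 - (z ^+ j) ^+ x) =
  (let g := gcdn j (p * n.+1) in
   if p %| (p * n.+1) %/ g then p ^ g else 0)%N%:R.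
Proof.
move=> pP zP; have N0 := prim_order_gt0 zP.
rewrite [(p * n.+1)%N]mulnC -/(N p n) /=.
rewrite (prod_D_prim_root _ _ _ _ _ pP _ (exp_prim_root zP j)); last first.
  by rewrite dvdn_divLR ?dvdn_gcdr ?gcdn_gt0 ?N0 ?orbT // dvdn_mulr.
have gN : (gcdn j (N p n) %| N p n)%N by exact: dvdn_gcdr.
case: ifP => _ //; rewrite natrX; congr (_ ^+ _).
rewrite -{1}(divnK gN) mulKn // divn_gt0 ?gcdn_gt0 ?N0 ?orbT //.
exact: dvdn_leq.
Qed.

Lemma M1_approx (p n : nat) (b : 'Z_(N p n)) : prime p ->
  `| (p * n.+1)%:Z * M 1 b
     - p%:Z ^+ n.+1 * ((if (p %| b)%N then p%:Z else 0) - 1) |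
  <= (M1_error p n)%:Z.
Proof.
move=> pP; have p0 := prime_gt0 pP; have p1 := prime_gt1 pP.
have N1 : (1 < N p n)%N by rewrite /N mulSn ltn_addr.
have [z zP] := C_prim_root_exists (ltnW N1).
have zn : p.-primitive_root (z ^+ n.+1).
  by have := exp_prim_root zP n.+1; rewrite (gcdn_idPl _) ?dvdn_mulr ?mulKn.
have bN : (b < N p n)%N by rewrite -[X in (_ < X)%N](Zp_cast N1).
have zNorm : `|z| = 1.
  apply/eqP; rewrite -(@pexpr_eq1 _ _ (N p n)) ?normr_ge0 ?(ltnW N1) //.
  by rewrite -normrX (prim_expr_order zP) normr1.
have := M1_fourier _ _ b _ _ N1 zP.
under eq_bigr do rewrite (prod_D_expr _ _ _ _ _ pP zP).
rewrite -(big_mkord xpredT (fun j => z ^+ (j * (N p n - b)) *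
   (let g := gcdn j (p * n.+1) in
   if p %| (p * n.+1) %/ g then p ^ g else 0)%N%:R)).
rewrite {2}/N mulnC (bigID (fun j => n.+1 %| j)%N) /= sum_nat_dvd //.
(* The index 0 is the root 1, of order 1, where the product vanishes. *)
rewrite big_ltn // mul0n gcd0n divnn muln_gt0 p0 /= dvdn1 gtn_eqF // mulr0 add0r.
have mainE : \sum_(1 <= k < p) z ^+ (k * n.+1 * (N p n - b)) *
      (if p %| p * n.+1 %/ gcdn (k * n.+1) (p * n.+1)
       then p ^ gcdn (k * n.+1) (p * n.+1) else 0)%N%:R
    = p%:R ^+ n.+1 * ((if (p %| b)%N then p%:R else 0) - 1).
  (* The Ramanujan sum is the sum over all p-th roots of unity minus the term of the root 1. *)
  have -> : (if (p %| b)%N then p%:R else 0) - 1 =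
      \sum_(1 <= k < p) (z ^+ n.+1) ^+ (k * (N p n - b)).
    have := sum_prim_root _ _ (N p n - b) _ zn.
    rewrite -(big_mkord xpredT (fun j => (z ^+ n.+1) ^+ (j * (N p n - b)))).
    rewrite big_ltn // mul0n expr0 dvdn_subr ?dvdn_mull ?(ltnW bN) // => <-.
    by rewrite addrAC subrr add0r.
  rewrite mulr_sumr; apply: eq_big_nat => k /andP[k0 kp].
  (* For 0 < k < p the root z^(k(n+1)) has order exactly p. *)
  have kg : gcdn (k * n.+1) (p * n.+1) = n.+1.
    rewrite -muln_gcdl -[RHS]mul1n; congr (_ * _)%N; apply/eqP.
    by rewrite -/(coprime _ _) coprime_sym prime_coprime // gtnNdvd.
  rewrite kg mulnK // dvdnn natrX mulrC -exprM; congr (_ * _ ^+ _).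
  by rewrite mulnCA mulnA.
rewrite mainE => {mainE} H.
rewrite -(ler_int algC) intr_norm intrB !intrM rmorphXn /= rmorphB /=.
have -> : (if (p %| b)%N then p%:Z else 0)%:~R =
          (if (p %| b)%N then p%:R else 0) :> algC by case: ifP.
rewrite -!pmulrn [(p * n.+1)%N]mulnC H addrAC subrr add0r.
rewrite natr_sum; apply: le_trans (ler_norm_sum _ _ _) _.
apply: ler_sum => j _; rewrite normrM normrX zNorm expr1n mul1r.
by rewrite normr_nat.
Qed.

(** * The case p = 5 *)

Lemma M1_5_approx (n : nat) (b : 'Z_(N 5 n)) :
  `|n.+1%:Z * M 1 b - 5 ^+ n * (if (5 %| b)%N then 4 else -1)|
    <= n%:Z * 5 ^+ (n.+1)./2.
Proof.
have := M1_approx 5 n b isT.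
have -> : (if (5 %| b)%N then 5%:Z else 0) - 1 = if (5 %| b)%N then 4 else -1.
  by case: ifP.
move=> H; have {H} := le_trans H (_ : _ <= (5 * n * 5 ^ (n.+1)./2)%N%:Z).
rewrite lez_nat => /(_ (M1_error_le 5 n isT)).
rewrite exprS !PoszM -!mulrA -mulrBr normrM ler_pM2l // => H.
by apply: le_trans H _; rewrite -natrX natz.
Qed.

(** The main term is 4 * 5^(n+1) or -5^(n+1). Comparing it with [M1_error] itself, rather than with
    its upper bound, settles the sign from n = 1 on. *)
Lemma M1_5_sign (n : nat) (b : 'Z_(N 5 n)) : (0 < n)%N ->
  if (5 %| b)%N then 0 < M 1 b else M 1 b < 0.
Proof.
move=> n0; have := M1_approx 5 n b isT.
have : (M1_error 5 n)%:Z < 5 ^+ n.+1.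
  by rewrite -natrX natz ltz_nat M1_5_error_lt.
move: (M1_error 5 n)%:Z (5 ^+ n.+1) => e q eq.
rewrite PoszM; case: ifP => _; rewrite ler_norml => /andP[H1 H2].
  by rewrite ltNge; apply/negP => M0; nia.
by rewrite ltNge; apply/negP => M0; nia.
Qed.

(** By [M1_5_approx] the relative error is at most n / 5^h with h = [n./2]; this makes it at most 4
    / (n+1). Indeed n(n+1) <= 4 (h+1)^2 and (h+1)^2 <= 5^h. *)
Lemma mul_succ_le_expn_half (n : nat) : (n * n.+1 <= 4 * 5 ^ n./2)%N.
Proof.
have H m : (m.+1 * m.+1 <= 5 ^ m)%N.
  by elim: m => // m IH; rewrite expnS; nia.
apply: leq_trans (_ : (4 * (n./2.+1 * n./2.+1) <= _)%N); last first.
  by rewrite leq_mul2l H.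
have : (n <= n./2.*2.+1)%N by lia.
by move: n./2 => h; nia.
Qed.

Theorem theorem4p5 (R : realType) :
  (exists o1 : forall n : nat, 'Z_(N 5 n) -> R,
     (forall e : R, 0 < e ->
        \forall n \near \oo, forall b : 'Z_(N 5 n), `|o1 n b| < e)
     /\ (forall (n : nat) (b : 'Z_(N 5 n)), (0 < n)%N ->
           (M 1 b)%:~R =
           (if (5 %| (b : nat))%N
            then 4 * 5 ^+ n / n.+1%:R
            else - (5 ^+ n / n.+1%:R)) * (1 + o1 n b)))
  /\ (forall (n : nat) (b : 'Z_(N 5 n)), (0 < n)%N ->
        ((5 %| (b : nat))%N -> 0 < M 1 b)
        /\ (~~ (5 %| (b : nat))%N -> M 1 b < 0)).
Proof.
split; last first.
  move=> n b n0; have := M1_5_sign n b n0.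
  by case: (5 %| b)%N.
pose c (n : nat) (b : 'Z_(N 5 n)) : R := if (5 %| b)%N then 4 else -1.
have c0 n b : c n b != 0.
  by rewrite /c; case: ifP; rewrite ?oppr_eq0 ?oner_eq0 ?pnatr_eq0.
have mainE n (b : 'Z_(N 5 n)) :
    (if (5 %| (b : nat))%N then 4 * 5 ^+ n / n.+1%:R
     else - (5 ^+ n / n.+1%:R)) = c n b * 5 ^+ n / n.+1%:R.
  by rewrite /c; case: ifP => // _; rewrite !mulN1r mulNr.
have p5 n : 0 < 5 ^+ n :> R by rewrite exprn_gt0.
(* [o1] is the exact relative error, so the identity is pure algebra and only the limit, uniform in
   b, remains. *)
exists (fun n b => (n.+1%:R * (M 1 b)%:~R - 5 ^+ n * c n b) / (5 ^+ n * c n b)).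
split=> [e e0|n b n0]; last first.
  by rewrite mainE; field; rewrite c0 (gt_eqF (p5 n)) addrC natr1 pnatr_eq0.
(* The 4 is the constant of [mul_succ_le_expn_half]. *)
have e4 : 0 < e / 4 by rewrite divr_gt0.
near=> n => b.
have nS : n.+1%:R^-1 < e / 4.
  by near: n; exact: (near_infty_natSinv_lt (PosNum e4)).
rewrite normrM normfV normrM (gtr0_norm (p5 n)).
have c1 : 1 <= `|c n b|.
  by rewrite /c; case: ifP; rewrite ?normrN ?normr1 ?normr_nat ?ler1n.
rewrite ltr_pdivrMr ?mulr_gt0 ?p5 ?(lt_le_trans ltr01) //.
have H : `|n.+1%:R * (M 1 b)%:~R - 5 ^+ n * c n b| <= n%:R * 5 ^+ (n.+1)./2.
  have := M1_5_approx n b.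
  rewrite -(ler_int R) intr_norm intrB !intrM !rmorphXn /=.
  rewrite -!pmulrn /c; congr (`|_ - _ * _| <= _).
  by case: ifP.
apply: (le_lt_trans H).
have nS' : 4 < e * n.+1%:R.
  by move: nS; rewrite ltr_pdivlMr // mulrC ltr_pdivrMr ?ltr0n.
apply: (@lt_le_trans _ _ (e * 5 ^+ n)); last first.
  by rewrite ler_pM2l //; apply: ler_peMr => //; exact: ltW.
(* Splitting 5^n this way cancels the power of 5 in the error and leaves n < e 5^h with h = [n./2],
   shown after multiplying by n+1. *)
have nE : n = (n./2 + (n.+1)./2)%N by lia.
rewrite [in 5 ^+ n]nE exprD mulrA ltr_pM2r //.
rewrite -(@ltr_pM2r _ n.+1%:R) ?ltr0n //.
apply: (@le_lt_trans _ _ (4 * 5 ^+ n./2)).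
  by rewrite -natrX -!natrM ler_nat mul_succ_le_expn_half.
by rewrite mulrAC ltr_pM2r.
Unshelve. all: by end_near.
Qed.
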